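(* Let $G$ be a finitely generated infinite group and let $A$ be a finite-dimensional vector space over a field $K$. Let $\Sigma \subset A^G$ be a topologically mixing linear subshift (e.g., $\Sigma = A^G$) and let $\tau \colon \Sigma \to \Sigma$ be a linear cellular automaton, with limit set $\Omega(\tau) = \bigcap_{n \geq 1} \tau^n(\Sigma)$. Then the following conditions are equivalent: (a) $\tau$ is nilpotent; (b) $\tau$ is pointwise nilpotent; (c) there exists $n_0 \in \mathbb{N}$ such that $\tau^{n_0}(\Sigma)$ is finite-dimensional; (d) $\Omega(\tau)$ is finite-dimensional; (e) $\Omega(\tau) = \{0\}$.
   Context: $A^G$ is the $K$-vector space of all maps $x \colon G \to A$, equipped with the prodiscrete topology (product topology with each factor $A$ discrete) and with the shift action $(gx)(h) = x(g^{-1}h)$. A linear subshift of $A^G$ is a closed $G$-invariant vector subspace of $A^G$. A linear cellular automaton $A^G \to A^G$ is a map $\tilde\tau$ for which there exist a finite subset $M \subset G$ and a $K$-linear map $\mu \colon A^M \to A$ with $\tilde\tau(x)(g) = \mu((g^{-1}x)|_M)$ for all $x \in A^G$, $g \in G$. A linear cellular automaton $\tau \colon \Sigma \to \Sigma$ is a map that is the restriction of a linear cellular automaton $A^G \to A^G$. The subshift $\Sigma$ is topologically mixing if for any two nonempty open subsets $U, V \subset \Sigma$ there exists a finite subset $F \subset G$ such that $U \cap gV \neq \varnothing$ for all $g \in G \setminus F$. A map $f \colon X \to X$ is nilpotent if there exist a constant map $c \colon X \to X$ and an integer $n_0 \geq 1$ such that $f^{n_0} = c$ and hence $f^n = c$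 for all $n \geq n_0$ (for linear $f$ this means $f^{n_0} = 0$ for some $n_0 \ge 1$). It is pointwise nilpotent if there exists $x_0 \in X$ such that for each $x \in X$ there is an integer $n_x \geq 1$ with $f^n(x) = x_0$ for all $n \geq n_x$. $\mathbb{N}$ denotes the non-negative integers. *)

(* Defs.v *)
From HB Require Import structures.
From mathcomp Require Import all_boot all_order all_algebra.
From mathcomp Require Import finmap.
From mathcomp Require Import boolp classical_sets functions cardinality.
From mathcomp Require Import topology.

Set Implicit Arguments.
Unset Strict Implicit.
Unset Printing Implicit Defensive.

Import GRing.Theory.

Local Open Scope classical_set_scope.
Local Open Scope ring_scope.

Definition finitely_generated (G : groupType) : Prop :=
  exists S : {fset G}, forall H : set G,
    group_closed [in H] -> [set` S] `<=` H -> H = [set: G].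

(* The product, over G, of copies of the discrete space A. *)
Definition prodiscrete (G : groupType) (A : choiceType) : topologicalType :=
  prod_topology (fun _ : G => discrete_topology A).

Definition shift (G : groupType) (A : Type) (g : G) (x : G -> A) : G -> A :=
  fun h => x (g^-1 * h)%g.

Definition finite_dimensional (K : fieldType) (V : lmodType K) (W : set V) :
    Prop :=
  exists (n : nat) (e : 'I_n -> V),
    W = [set v | exists c : 'I_n -> K, v = \sum_(i < n) c i *: e i].

Definition linear_subshift (K : fieldType) (A : vectType K) (G : groupType)
    (Sigma : set (G -> A)) : Prop :=
  [/\ closed (Sigma : set (prodiscrete G A)),
      forall g : G, shift g @` Sigma `<=` Sigma
    & submod_closed [in Sigma]].

(* U is an open subset of the subspace Sigma of A^G. *)
Definition open_in (G : groupType) (A : choiceType) (Sigma U : set (G -> A)) :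
    Prop :=
  exists2 O : set (prodiscrete G A), open O & U = Sigma `&` O.

Definition topologically_mixing (G : groupType) (A : choiceType)
    (Sigma : set (G -> A)) : Prop :=
  forall U V : set (G -> A),
    open_in Sigma U -> open_in Sigma V -> U !=set0 -> V !=set0 ->
    exists F : {fset G}, forall g : G, g \notin F ->
      U `&` (shift g @` V) !=set0.

Definition linear_CA (K : fieldType) (A : vectType K) (G : groupType)
    (T : (G -> A) -> (G -> A)) : Prop :=
  exists (M : {fset G}) (mu : {linear {ffun M -> A} -> A}),
    forall (x : G -> A) (g : G),
      T x g = mu [ffun m : M => shift (g^-1)%g x (val m)].

Definition linear_CA_on (K : fieldType) (A : vectType K) (G : groupType)
    (Sigma : set (G -> A)) (tau : Sigma -> Sigma) : Prop :=
  exists2 T : (G -> A) -> (G -> A), linear_CA T &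
    forall x : Sigma, val (tau x) = T (val x).

Definition nilpotent_map (X : Type) (f : X -> X) : Prop :=
  exists (c : X) (n0 : nat), (1 <= n0)%N /\ iter n0 f = fun=> c.

Definition pointwise_nilpotent_map (X : Type) (f : X -> X) : Prop :=
  exists x0 : X, forall x : X, exists nx : nat,
    (1 <= nx)%N /\ forall n : nat, (nx <= n)%N -> iter n f x = x0.

(* The iterated image tau^n(Sigma) and the limit set, as subsets of A^G. *)
Definition iter_image (T : Type) (Sigma : set T) (tau : Sigma -> Sigma)
    (n : nat) : set T :=
  range (fun x : Sigma => val (iter n tau x)).

Definition limit_set (T : Type) (Sigma : set T) (tau : Sigma -> Sigma) :
    set T :=
  \bigcap_(n in [set n | (1 <= n)%N]) iter_image tau n.

(* Main.v *)
Require Import Defs.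
From HB Require Import structures.
From mathcomp Require Import all_boot all_order all_algebra.
From mathcomp Require Import finmap.
From mathcomp Require Import boolp classical_sets functions cardinality.
From mathcomp Require Import topology.

Import GRing.Theory.

Local Open Scope classical_set_scope.
Local Open Scope ring_scope.

(** A decreasing sequence of nonempty closed affine subsets of [A^I], [A]
    finite-dimensional, has a common point (linear compactness).
    - If [tau] is pointwise nilpotent, a Baire argument makes the kernel of some
      [tau^n] contain all points of [Sigma] vanishing on a finite window; by
      mixing, the pattern of any [u] on another window occurs in a translate of
      such a point, so [tau^n = 0]. The same argument applies when
      [tau^n(Sigma)] is finite-dimensional, as its points are then determined by
      a finite window.
    - If the limit set [Omega] is finite-dimensional, finite generation of [G]
      makes it a subshift of finite type, with some defining window [D]. The
      decreasing spaces [tau^n(Sigma)|_D] stabilise, and linear compactness of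
      the space of backward orbits shows that they stabilise to [Omega|_D];
      hence [tau^n(Sigma) = Omega] for some [n]. *)

(** * Linear compactness of powers of a finite-dimensional space *)

Section LinearCompactness.
Context {K : fieldType}.

Definition subspace_set (V : lmodType K) (D : set V) : Prop :=
  D 0 /\ forall (c : K) (x y : V), D x -> D y -> D (c *: x + y).

(** Take a [{vspace V}] of maximal dimension inside [D]: adjoining the line of a vector of [D] stays
    inside [D], so it cannot enlarge it. *)
Lemma subspace_set_vspace (V : vectType K) (D : set V) :
  subspace_set V D -> exists W : {vspace V}, forall v, D v <-> v \in W.
Proof.
move=> [D0 DS].
pose P n :=
  `[< exists2 W : {vspace V}, (forall v, v \in W -> D v) & \dim W = n >].
have exP : exists n, P n.
  exists 0%N; apply/asboolP; exists 0%VS; last exact: dimv0.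
  by move=> v; rewrite memv0 => /eqP ->.
have ubP n : P n -> (n <= \dim {:V})%N.
  by move=> /asboolP [W _ <-]; exact/dimvS/subvf.
case: (ex_maxnP exP ubP) => n /asboolP [W WD Wn] maxn.
exists W => v; split; last exact: WD.
move=> Dv; have /maxn : P (\dim (W + <[v]>)%VS).
  apply/asboolP; exists (W + <[v]>)%VS => // _ /memv_addP [w Ww [_ /vlineP [k ->] ->]].
  by rewrite addrC; apply: DS => //; exact: WD.
rewrite -Wn => le.
have /eqP -> : W == (W + <[v]>)%VS by rewrite eqEdim addvSl.
by rewrite (subvP (addvSr W <[v]>)) // memv_line.
Qed.

(** Choose [D i] of least dimension; a member below both [D i] and [D j] then has to equal [D i]. *)
Lemma directed_subspaces_min (V : vectType K) (J : Type) (D : J -> set V) :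
  inhabited J -> (forall j, subspace_set V (D j)) ->
  (forall i j, exists k, D k `<=` D i /\ D k `<=` D j) ->
  exists i, forall j, D i `<=` D j.
Proof.
move=> [j0] Dsub dir.
have [W WP] := choice (fun j => subspace_set_vspace _ _ (Dsub j)).
pose P n := `[< exists i, \dim (W i) = n >].
have exP : exists n, P n by exists (\dim (W j0)); apply/asboolP; exists j0.
case: (ex_minnP exP) => n /asboolP [i <-] min; exists i => j.
have [k [ki kj]] := dir i j.
have le : (\dim (W i) <= \dim (W k))%N by apply: min; apply/asboolP; exists k.
have /eqP Wki : W k == W i.
  by rewrite eqEdim le andbT; apply/subvP => v /WP/ki/WP.
by move=> v /WP; rewrite -Wki => /WP/kj.
Qed.

(** Three points are used because closure under lines through two points is vacuous over the field
    with two elements. The empty set is allowed. *)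
Definition affine_set (V : lmodType K) (E : set V) : Prop :=
  forall (x y z : V) (c : K), E x -> E y -> E z -> E (x + c *: (y - z)).

Lemma subspace_affine (V : lmodType K) (E : set V) :
  subspace_set V E -> affine_set V E.
Proof.
move=> [_ ES] x y z c Ex Ey Ez; rewrite addrC; apply: (ES) => //.
by rewrite addrC -scaleN1r; apply: ES.
Qed.

Variables (A : vectType K) (I : eqType).

(** Closedness for the prodiscrete topology, phrased by finite windows so that it also serves the
    index type [nat * G] of backward orbits. *)
Definition finitely_closed (E : set (I -> A)) : Prop :=
  forall x, (forall F : seq I, exists2 y, E y & {in F, x =1 y}) -> E x.

Definition bigmeet (s : seq (set (I -> A))) : set (I -> A) :=
  [set x | forall E, E \in s -> E x].

Definition affine_fip (C : set (set (I -> A))) : Prop :=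
  (forall E, C E -> affine_set _ E) /\
  (forall s : seq (set (I -> A)), (forall E, E \in s -> C E) -> bigmeet s !=set0).

(** The differences of [i]-th coordinates over a finite intersection form a subspace of [A]. Where
    this subspace is smallest, any value taken at [i] survives in every further finite
    intersection. *)
Lemma affine_fip_coord (C : set (set (I -> A))) (i : I) : affine_fip C ->
  exists p, affine_fip ([set x | x i = p] |` C).
Proof.
move=> [Caff Cfip].
pose J := {s : seq (set (I -> A)) | forall E, E \in s -> C E}.
pose D (s : J) : set A :=
  [set a | exists x y, [/\ bigmeet (sval s) x, bigmeet (sval s) y & a = x i - y i]].
have aff (s : J) : affine_set _ (bigmeet (sval s)).
  move=> x y z c mx my mz E Es.
  by apply: (Caff E (svalP s E Es)); [exact: mx | exact: my | exact: mz].
have catP (s t : J) : exists u : J,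
    bigmeet (sval u) `<=` bigmeet (sval s) /\ bigmeet (sval u) `<=` bigmeet (sval t).
  have st E : E \in (sval s ++ sval t) -> C E.
    by rewrite mem_cat => /orP [] ?; [exact: (svalP s) | exact: (svalP t)].
  by exists (exist _ _ st); split=> x mx E Es; apply: mx; rewrite /= mem_cat Es ?orbT.
have Dsub (s : J) : subspace_set _ (D s).
  split.
    by have [x mx] := Cfip _ (svalP s); exists x, x; rewrite subrr.
  move=> c _ _ [x [y [mx my ->]]] [u [v [mu mv ->]]].
  exists (u + c *: (x - y)), v; split=> //; first exact: aff.
  by rewrite /= !fctE addrCA addrA.
have Jinh : inhabited J by constructor; exists [::].
have [|s smin] := directed_subspaces_min _ J D Jinh Dsub.
  move=> s t; have [u [us ut]] := catP s t; exists u.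
  by split=> _ [x [y [mx my ->]]]; exists x, y; split; auto.
have [x0 mx0] := Cfip _ (svalP s).
exists (x0 i); split.
  move=> E [->|]; last exact: Caff.
  by move=> x y z c /= xi yi zi; rewrite !fctE xi yi zi subrr scaler0 addr0.
move=> t tC.
(* Split off the condition on coordinate [i]: the members of [t'] all come from [C]. *)
have [t' [t'C tt']] : exists t' : seq (set (I -> A)), (forall E, E \in t' -> C E) /\
    forall y, bigmeet t' y -> y i = x0 i -> bigmeet t y.
  elim: t tC => [|E t IH] tC; first by exists [::].
  have [|t' [t'C tt']] := IH; first by move=> E' H; apply: tC; rewrite inE H orbT.
  have [->|CE] := tC E (mem_head _ _).
    by exists t'; split=> // y my yi E'; rewrite inE => /orP [/eqP ->//|]; exact: tt'.
  exists (E :: t'); split; first by move=> E'; rewrite inE => /orP [/eqP ->//|]; exact: t'C.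
  move=> y my yi E'; rewrite inE => /orP [/eqP ->|].
    exact: my (mem_head _ _).
  by apply: tt' => // E'' H; apply: my; rewrite inE H orbT.
have [u [us ut]] := catP s (exist _ _ t'C).
have [z mz] := Cfip _ (svalP u).
(* By minimality the defect of [z] at [i] is also a difference of two points of the smaller
   intersection, so [z] can be corrected without leaving it. *)
have /(smin u) [v [w [mv mw vw]]] : D s (x0 i - z i) by exists x0, z; split; auto.
exists (z + 1 *: (v - w)); apply: tt'; first by apply: ut; exact: aff.
by rewrite !fctE scale1r -vw addrC subrK.
Qed.

(* A maximal family of affine sets with the finite intersection property
   fixes every coordinate, and the point with these coordinates lies in
   every finitely closed member. *)
Lemma affine_compactness (C : set (set (I -> A))) : affine_fip C ->
  (forall E, C E -> finitely_closed E) -> exists x, forall E, C E -> E x.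
Proof.
move=> Cfip Ccl.
have [F FF totF|M [MC Mmax]] :=
    @Zorn_bigcup _ [set M : set (set (I -> A)) | affine_fip (M `|` C)].
  split.
    by move=> E [[X /FF [+ _] XE]|]; [apply; left | exact: (proj1 Cfip)].
  move=> s sF.
  suff [X [XF sX]] : exists X : set (set (I -> A)), affine_fip (X `|` C) /\
      forall E, E \in s -> (X `|` C) E by exact: (proj2 XF).
  suff [X [XF sX]] : exists X : set (set (I -> A)), (F X \/ X = set0) /\
      forall E, E \in s -> (X `|` C) E.
    exists X; split=> //; case: XF => [/FF //|->].
    by rewrite set0U.
  elim: s sF => [|E s IH] sF; first by exists set0; split=> //; right.
  have [|X [XF sX]] := IH; first by move=> E' H; apply: sF; rewrite inE H orbT.
  have [[Y FY YE]|CE] := sF E (mem_head _ _); last first.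
    by exists X; split=> // E'; rewrite inE => /orP [/eqP ->|]; [right | exact: sX].
  case: XF => [FX|X0]; last first.
    exists Y; split; first by left.
    by move=> E'; rewrite inE => /orP [/eqP ->|/sX]; [left | rewrite X0 set0U; right].
  have [XY|YX] := totF X Y FX FY.
    exists Y; split; first by left.
    by move=> E'; rewrite inE => /orP [/eqP ->|/sX [/XY|]]; [left | left | right].
  exists X; split; first by left.
  by move=> E'; rewrite inE => /orP [/eqP ->|]; [left; exact: YX | exact: sX].
have coord i : exists p, (M `|` C) [set x | x i = p].
  have [p fp] := affine_fip_coord _ i MC.
  exists p; left; apply: contrapT => nM.
  apply: (Mmax ([set x | x i = p] |` M)); last by rewrite /= -setUA.
  split; last by move=> MS; apply: nM; apply: MS; left.
  by move=> E ME; right.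
have [x xP] := choice coord.
exists x => E CE; apply: (Ccl E CE) => F.
have [|y my] := proj2 MC (E :: [seq [set y | y i = x i] | i <- F]).
  move=> E'; rewrite inE => /orP [/eqP ->|/mapP [i _ ->]]; first by right.
  exact: xP.
exists y; first exact: my (mem_head _ _).
move=> i iF; apply/esym; apply: (my [set y | y i = x i]).
by rewrite inE; apply/orP; right; apply/mapP; exists i.
Qed.

Lemma nested_affine_nonempty (E : nat -> set (I -> A)) :
  (forall n, affine_set _ (E n)) -> (forall n, finitely_closed (E n)) ->
  (forall n, E n.+1 `<=` E n) -> (forall n, E n !=set0) ->
  exists x, forall n, E n x.
Proof.
move=> Eaff Ecl Edec Ene.
have mono m n : (m <= n)%N -> E n `<=` E m.
  elim: n => [|n IH]; first by rewrite leqn0 => /eqP ->.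
  by rewrite leq_eqVlt => /orP [/eqP -> //|/IH le] x /Edec/le.
have [||x xP] := affine_compactness (range E); last first.
- by exists x => n; apply: xP; exists n.
- by move=> _ [n _ <-].
split; first by move=> _ [n _ <-].
move=> s sE.
have [n nP] : exists n, E n `<=` bigmeet s.
  elim: s sE => [|X s IH] sE; first by exists 0%N.
  have [|n nP] := IH; first by move=> Y H; apply: sE; rewrite inE H orbT.
  have [m _ mX] := sE X (mem_head _ _).
  exists (maxn m n) => x Ex Y; rewrite inE => /orP [/eqP ->|H].
    by rewrite -mX; apply: mono Ex; exact: leq_maxl.
  by apply: nP H; apply: mono Ex; exact: leq_maxr.
by have [x Ex] := Ene n; exists x; exact: nP.
Qed.

End LinearCompactness.

(** * Cylinders in the prodiscrete topology *)

Section Prodiscrete.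
Context {G : groupType} {A : choiceType}.

(** The sets containing a cylinder around [x] form a filter, and it converges to [x] in each
    coordinate, hence in the product. *)
Lemma nbhs_prodiscrete_cylinder (x : prodiscrete G A) (B : set (prodiscrete G A)) :
  nbhs x B -> exists F : seq G, forall y : G -> A, {in F, x =1 y} -> B y.
Proof.
pose cyl : set_system (prodiscrete G A) :=
  [set B | exists F : seq G, forall y : G -> A, {in F, x =1 y} -> B y].
have cylF : Filter cyl.
  split; first by exists [::].
  - move=> P Q [F FP] [F' FQ]; exists (F ++ F') => y xy.
    by split; [apply: FP | apply: FQ] => g gF; apply: xy; rewrite mem_cat gF ?orbT.
  - by move=> P Q PQ [F FP]; exists F => y /FP/PQ.
suff : cyl --> x by apply.
apply/cvg_sup => g D [_ [[O _ <-] Ox OD]].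
exists [:: g] => y xy; apply: OD => /=.
by rewrite -[y g]xy ?mem_head.
Qed.

Lemma open_cylinder (x : G -> A) (F : seq G) :
  open ([set y | {in F, x =1 y}] : set (prodiscrete G A)).
Proof.
elim: F => [|g F IH].
  by rewrite (_ : [set _ | _] = setT) ?predeqE //; exact: openT.
have -> : [set y : prodiscrete G A | {in g :: F, x =1 y}] =
    [set y | x g = y g] `&` [set y | {in F, x =1 y}].
  apply/seteqP; split=> [y xy|y [xg xy] h].
    by split=> [|h hF]; apply: xy; rewrite inE ?eqxx // hF orbT.
  by rewrite inE => /orP [/eqP ->|/xy].
apply: openI IH.
have -> : [set y : prodiscrete G A | x g = y g] =
    mathcomp_extra.proj g @^-1` [set x g : discrete_topology A].
  by apply/seteqP; split=> y /=; rewrite /mathcomp_extra.proj => ->.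
apply: open_comp; last exact: discrete_open.
by move=> y _; exact: proj_continuous.
Qed.

Lemma open_in_cylinder (Sigma : set (G -> A)) (x : G -> A) (F : seq G) :
  open_in Sigma (Sigma `&` [set y | {in F, x =1 y}]).
Proof. by exists [set y | {in F, x =1 y}] => //; exact: open_cylinder. Qed.

Lemma closed_prodiscrete (Sigma : set (G -> A)) (x : G -> A) :
  closed (Sigma : set (prodiscrete G A)) ->
  (forall F : seq G, exists2 y, Sigma y & {in F, x =1 y}) -> Sigma x.
Proof.
move=> cl xP; apply: cl => B /nbhs_prodiscrete_cylinder [F FB].
by have [y Sy xy] := xP F; exists y; split=> //; exact: FB.
Qed.

(** As [G] is infinite, some [g] avoids the finite exceptional set given by mixing. *)
Lemma mixing_cylinders (Sigma : set (G -> A)) (x y : G -> A) (F : seq G) :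
  infinite_set [set: G] -> topologically_mixing Sigma -> Sigma x -> Sigma y ->
  exists (g : G) (z : G -> A),
    [/\ Sigma z, {in F, y =1 z} & {in F, x =1 shift g z}].
Proof.
move=> Ginf mix Sx Sy.
have [||||N NP] := mix (Sigma `&` [set z | {in F, x =1 z}])
  (Sigma `&` [set z | {in F, y =1 z}]).
- exact: open_in_cylinder.
- exact: open_in_cylinder.
- by exists x.
- by exists y.
have [g gN] : exists g, g \notin N.
  apply: contrapT => nN; apply: Ginf.
  suff -> : [set: G] = [set` N] by exact: finite_fset.
  apply/seteqP; split=> // g _ /=.
  by apply/negPn/negP => gN; apply: nN; exists g.
have [z' [[_ xz] [z [Sz yz] zE]]] := NP g gN.
by exists g, z; rewrite zE.
Qed.

End Prodiscrete.

(** * Linear cellular automata on linear subshifts *)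

Section LinearSubshifts.
Context {K : fieldType} {A : vectType K} {G : groupType}.

Lemma shiftM (g h : G) (x : G -> A) : shift g (shift h x) = shift (g * h)%g x.
Proof. by apply/funext => k; rewrite /shift invgM mulgA. Qed.

Lemma shift1 (x : G -> A) : shift 1%g x = x.
Proof. by apply/funext => k; rewrite /shift invg1 mul1g. Qed.

Lemma shiftVK (g : G) (x : G -> A) : shift g^-1%g (shift g x) = x.
Proof. by rewrite shiftM mulVg shift1. Qed.

Lemma shift0 (g : G) : shift g (0 : G -> A) = 0.
Proof. by apply/funext. Qed.

(* The axiomatic form of a linear cellular automaton, stable under iteration. *)
Record local_linear (T : (G -> A) -> G -> A) : Prop := LocalLinear {
  local_linear_comb : forall (c : K) (x y : G -> A), T (c *: x + y) = c *: T x + T y;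
  local_linear_shift : forall (g : G) (x : G -> A), T (shift g x) = shift g (T x);
  local_linear_window : forall F : seq G, exists N : seq G,
    forall x y : G -> A, {in N, x =1 y} -> {in F, T x =1 T y} }.

Lemma linear_CA_local_linear (T : (G -> A) -> G -> A) :
  linear_CA T -> local_linear T.
Proof.
move=> [M [mu TE]]; split.
- move=> c x y; apply/funext => g; rewrite !fctE !TE -linearP /=; congr (mu _).
  by apply/ffunP => m; rewrite !ffunE.
- move=> g x; apply/funext => h; rewrite /shift !TE; congr (mu _).
  by apply/ffunP => m; rewrite !ffunE /shift !invgK mulgA.
move=> F; exists [seq (g * m)%g | g <- F, m <- enum_fset M] => x y xy g gF.
rewrite !TE; congr (mu _); apply/ffunP => m; rewrite !ffunE /shift invgK.
by apply: xy; apply/allpairsP; exists (g, val m); split=> //=; exact: valP.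
Qed.

Lemma local_linear_iter (T : (G -> A) -> G -> A) (n : nat) :
  local_linear T -> local_linear (iter n T).
Proof.
move=> TL; elim: n => [|n [IHl IHs IHw]].
  by split=> // F; exists F.
split=> /=.
- by move=> c x y; rewrite IHl local_linear_comb.
- by move=> g x; rewrite IHs local_linear_shift.
move=> F; have [N NP] := local_linear_window _ TL F.
have [N' N'P] := IHw N; exists N' => x y /N'P/NP; exact.
Qed.

Lemma local_linear0 (T : (G -> A) -> G -> A) : local_linear T -> T 0 = 0.
Proof.
move=> TL; have := local_linear_comb _ TL (-1) 0 0.
by rewrite scaler0 addr0 scaleN1r addNr.
Qed.

(** The coefficient vectors whose combination vanishes on [F] form a directed family of subspaces of
    ['rV[K]_n]; a smallest one consists of combinations vanishing everywhere. The generators need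
    not be independent. *)
Lemma finite_dimensional_window (W : set (G -> A)) : finite_dimensional W ->
  exists F : seq G, forall w, W w -> {in F, w =1 0} -> w = 0.
Proof.
move=> [n [e ->]].
pose D (F : seq G) : set 'rV[K]_n :=
  [set c | {in F, forall g, \sum_(i < n) c ord0 i *: e i g = 0}].
have Dsub F : subspace_set _ (D F).
  split=> [g gF|k c d Dc Dd g gF].
    by rewrite big1 // => i _; rewrite mxE scale0r.
  under eq_bigr do rewrite !mxE scalerDl -scalerA.
  by rewrite big_split -scaler_sumr /= Dc // Dd // scaler0 addr0.
have [||F Fmin] := directed_subspaces_min _ _ D _ Dsub.
- by constructor; exact: [::].
- move=> F F'; exists (F ++ F').
  by split=> c Dc g gF; apply: Dc; rewrite mem_cat gF ?orbT.
exists F => _ [c ->] w0.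
have DE F' : D F' (\row_i c i) <-> {in F', \sum_(i < n) c i *: e i =1 0}.
  have sumE g : \sum_(i < n) (\row_j c j) ord0 i *: e i g =
      (\sum_(i < n) c i *: e i) g.
    by rewrite fct_sumE; apply: eq_bigr => i _; rewrite mxE.
  by split=> H g gF; have := H g gF; rewrite /= sumE.
apply/funext => g; move/DE: w0 => /(Fmin [:: g]) /DE; apply.
exact: mem_head.
Qed.

Context {Sigma : set (G -> A)}.
Hypotheses (Sigma_subshift : linear_subshift Sigma).

Lemma linear_subshift_subspace : subspace_set _ Sigma.
Proof.
case: Sigma_subshift => _ _ [S0 SS]; split; first exact: set_mem.
by move=> c x y Sx Sy; apply: set_mem; apply: SS; exact: mem_set.
Qed.

Lemma linear_subshift_shift (g : G) (x : G -> A) : Sigma x -> Sigma (shift g x).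
Proof. by case: Sigma_subshift => _ + _ Sx; apply; exists x. Qed.

Lemma linear_subshift_closed (x : G -> A) :
  (forall F : seq G, exists2 y, Sigma y & {in F, x =1 y}) -> Sigma x.
Proof. by case: Sigma_subshift => cl _ _; exact: closed_prodiscrete. Qed.

Context {T : (G -> A) -> G -> A}.
Hypotheses (TL : local_linear T) (TS : forall x, Sigma x -> Sigma (T x)).

Lemma iter_stable (n : nat) (x : G -> A) : Sigma x -> Sigma (iter n T x).
Proof. by move=> Sx; elim: n => //= n; exact: TS. Qed.

(** * Nilpotency criteria from mixing *)

Section Mixing.
Hypotheses (Ginf : infinite_set [set: G]) (mix : topologically_mixing Sigma).

Lemma mixing_to_zero (u : G -> A) (F : seq G) : Sigma u ->
  exists (g : G) (z : G -> A), [/\ Sigma z, {in F, u =1 z} & {in F, shift g z =1 0}].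
Proof.
move=> Su; have [g [z [Sz uz z0]]] :=
  mixing_cylinders _ _ _ F Ginf mix (proj1 linear_subshift_subspace) Su.
by exists g, z; split=> // h hF; rewrite -z0.
Qed.

(** The value of [iter n T u] at [h] depends only on [u] over a window [N]. Mixing gives [z] equal
    to [u] on [N] with a translate vanishing on [F]; that translate is killed, hence so is [z] by
    equivariance. *)
Lemma kernel_window_nilpotent (F : seq G) (n : nat) :
  (forall z, Sigma z -> {in F, z =1 0} -> iter n T z = 0) ->
  forall u, Sigma u -> iter n T u = 0.
Proof.
move=> ker u Su; apply/funext => h.
have Tn := local_linear_iter _ n TL.
have [N NP] := local_linear_window _ Tn [:: h].
have [g [z [Sz uz z0]]] := mixing_to_zero _ (F ++ N) Su.
have Tz : iter n T z = 0.
  have : iter n T (shift g z) = 0.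
    apply: ker; first exact: linear_subshift_shift.
    by move=> k kF; apply: z0; rewrite mem_cat kF.
  rewrite (local_linear_shift _ Tn) => E.
  by rewrite -(shiftVK g (iter n T z)) E shift0.
rewrite (NP u z _ h) ?mem_head ?Tz // => k kN.
by apply: uz; rewrite mem_cat kN orbT.
Qed.

(** If [F] separates the points of the image, a point vanishing on a memory window of [F] has zero
    image. *)
Lemma finite_dimensional_image_zero (n : nat) :
  finite_dimensional (iter n T @` Sigma) -> forall u, Sigma u -> iter n T u = 0.
Proof.
move=> /finite_dimensional_window [F FP].
have Tn := local_linear_iter _ n TL.
have [N NP] := local_linear_window _ Tn F.
apply: (kernel_window_nilpotent N) => z Sz z0.
apply: FP; first by exists z.
move=> g gF; have /NP/(_ g gF) -> : {in N, z =1 0} by [].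
by rewrite (local_linear0 _ Tn).
Qed.

(* If no kernel of an iterate contained a cylinder, a nested sequence of
   cylinders would produce a point outside all these kernels. *)
Lemma pointwise_nilpotent_nilpotent :
  (forall x, Sigma x -> exists n, iter n T x = 0) ->
  exists n, forall u, Sigma u -> iter n T u = 0.
Proof.
move=> pw; apply: contrapT => nnil.
have esc (n : nat) (F : seq G) :
    exists z, [/\ Sigma z, {in F, z =1 0} & iter n T z <> 0].
  apply: contrapT => nz; apply: nnil; exists n.
  apply: (kernel_window_nilpotent F) => z Sz z0.
  by apply: contrapT => Tz; apply: nz; exists z.
have [S0 SS] := linear_subshift_subspace.
pose X := {x | Sigma x}.
(* Shrink the cylinder [p] until it misses the kernel of [iter n T]: the new window contains a
   memory window of one coordinate where the iterate is nonzero. *)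
have step (n : nat) (p : X * seq G) : exists q : X * seq G,
    [/\ {subset p.2 <= q.2}, {in p.2, sval p.1 =1 sval q.1} &
     forall y, {in q.2, sval q.1 =1 y} -> iter n T y <> 0].
  case: p => -[x Sx] F /=.
  have Tn := local_linear_iter _ n TL.
  have [x' [Sx' xx' Tx']] :
      exists x', [/\ Sigma x', {in F, x =1 x'} & iter n T x' <> 0].
    have [Tx|Tx] := pselect (iter n T x = 0); last by exists x.
    (* Adding [z] leaves [x] unchanged on [F] but moves it out of the kernel. *)
    have [z [Sz z0 Tz]] := esc n F.
    exists (1 *: z + x); split; first exact: SS.
      by move=> g gF; rewrite !fctE scale1r z0 // add0r.
    by rewrite (local_linear_comb _ Tn) Tx scale1r addr0.
  have [g Tg] : exists g, iter n T x' g <> 0.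
    apply: contrapT => ng; apply: Tx'; apply/funext => g.
    by apply: contrapT => Tg; apply: ng; exists g.
  have [N NP] := local_linear_window _ Tn [:: g].
  exists (exist _ x' Sx', F ++ N); split=> //=.
    by move=> h hF; rewrite mem_cat hF.
  move=> y xy Ty; apply: Tg; rewrite (NP x' y _ g) ?mem_head ?Ty //.
  by move=> h hN; apply: xy; rewrite mem_cat hN orbT.
have [f fP] := choice (fun np : nat * (X * seq G) => step np.1 np.2).
pose p := fix p n : X * seq G :=
  if n is m.+1 then f (m, p m) else (exist _ 0 S0, [::]).
pose E n := [set x | Sigma x /\ {in (p n).2, sval (p n).1 =1 x}].
have [||||x xP] := nested_affine_nonempty _ _ E.
- move=> n x y z c [Sx px] [Sy py] [Sz pz]; split.
    exact: (subspace_affine _ _ linear_subshift_subspace).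
  by move=> g gF; rewrite !fctE -px // -py // -pz // subrr scaler0 addr0.
- move=> n x xP; split.
    by apply: linear_subshift_closed => F; have [y [Sy _] xy] := xP F; exists y.
  by move=> g gF; have [y [_ py] ->] := xP (p n).2; rewrite ?py.
- move=> n x [Sx px]; split=> // g gF.
  by have [sub eqp _] := fP (n, p n); rewrite eqp // px //; exact: sub.
- by move=> n; exists (sval (p n).1); split=> //; exact: svalP.
have [n] := pw x (proj1 (xP 0%N)).
by have [_ _] := fP (n, p n); apply; exact: (proj2 (xP n.+1)).
Qed.

End Mixing.

(** * Stabilisation of the images and the limit set *)

Lemma iter_image_window_stable (D : seq G) :
  exists n, forall x, Sigma x -> forall m, exists2 z, Sigma z &
    {in D, iter n T x =1 iter m T z}.
Proof.
have [S0 SS] := linear_subshift_subspace.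
pose V n : set {ffun seq_sub D -> A} :=
  [set v | exists2 x, Sigma x & v = [ffun d => iter n T x (val d)]].
have Vdec m k : V (m + k)%N `<=` V m.
  move=> _ [x Sx ->]; exists (iter k T x); first exact: iter_stable.
  by apply/ffunP => d; rewrite !ffunE iterD.
have Vsub n : subspace_set _ (V n).
  have Tn := local_linear_iter _ n TL; split.
    by exists 0 => //; apply/ffunP => d; rewrite !ffunE (local_linear0 _ Tn).
  move=> c _ _ [x Sx ->] [y Sy ->]; exists (c *: x + y); first exact: SS.
  by apply/ffunP => d; rewrite !ffunE (local_linear_comb _ Tn) !fctE.
have [||n nP] := directed_subspaces_min _ _ V _ Vsub.
- by constructor; exact: 0%N.
- by move=> i j; exists (i + j)%N; split; [|rewrite addnC]; exact: Vdec.
exists n => x Sx m.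
have [|z Sz /ffunP zP] := nP m [ffun d => iter n T x (val d)]; first by exists x.
by exists z => // d dD; have := zP (SeqSub dD); rewrite !ffunE.
Qed.

(* Linear compactness of the space of backward orbits x_0 <- x_1 <- ... with
   prescribed values of x_0 on D. *)
Lemma limit_set_window (D : seq G) (v : G -> A) :
  (forall m, exists2 z, Sigma z & {in D, v =1 iter m T z}) ->
  exists2 w, (forall m, (iter m T @` Sigma) w) & {in D, v =1 w}.
Proof.
move=> vP.
(* [X (n, g)] is the value at [g] of the [n]-th term of a sequence; only its first [N] backward
   relations are imposed, and a common point satisfies all of them. *)
pose E N : set (nat * G -> A) := [set X |
  [/\ forall n, Sigma (fun g => X (n, g)),
      forall n, (n < N)%N -> T (fun g => X (n.+1, g)) = (fun g => X (n, g)) &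
      {in D, forall d, v d = X (0%N, d)}]].
have [||||X XP] := nested_affine_nonempty _ _ E.
- move=> N X Y Z c [SX TX DX] [SY TY DY] [SZ TZ DZ].
  have comb n : (fun g => (X + c *: (Y - Z)) (n, g)) =
      c *: ((-1) *: (fun g => Z (n, g)) + (fun g => Y (n, g))) + (fun g => X (n, g)).
    apply/funext => g; rewrite !fctE addrC; congr (_ *: _ + _).
    by rewrite scaleN1r addrC.
  split.
  + move=> n; by rewrite comb; do 2!apply: (proj2 linear_subshift_subspace) => //.
  + by move=> n nN; rewrite !comb !(local_linear_comb _ TL) TX // TY // TZ.
  + by move=> d dD; rewrite !fctE -DX // -DY // -DZ // subrr scaler0 addr0.
- move=> N X XP; split.
  + move=> n; apply: linear_subshift_closed => F.
    have [Y [SY _ _] XY] := XP [seq (n, g) | g <- F].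
    by exists (fun g => Y (n, g)) => // g gF; apply: XY; exact: map_f.
  + move=> n nN; apply/funext => g.
    have [M MP] := local_linear_window _ TL [:: g].
    have [Y [_ TY _] XY] := XP ((n, g) :: [seq (n.+1, h) | h <- M]).
    rewrite XY ?mem_head // -[Y _](congr1 (fun y => y g) (TY n nN)).
    apply: MP; last exact: mem_head.
    by move=> h hM; apply: XY; rewrite inE map_f ?orbT.
  + move=> d dD; have [Y [_ _ DY] ->] := XP [:: (0%N, d)]; first exact: DY.
    exact: mem_head.
- by move=> N X [SX TX DX]; split=> // n nN; apply: TX; exact: ltnW.
- move=> N; have [z Sz zD] := vP N.
  (* Truncated subtraction makes every term from index [N] on equal to [z]. *)
  exists (fun p => iter (N - p.1) T z p.2); split=> /=.
  + by move=> n; exact: iter_stable.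
  + by move=> n nN; rewrite -[in RHS](subnSK nN).
  + by move=> d dD; rewrite subn0 zD.
exists (fun g => X (0%N, g)).
  move=> m; exists (fun g => X (m, g)); first by case: (XP 0%N).
  elim: m => //= m IH; rewrite -iterS iterSr.
  by have [_ -> //] := XP m.+1.
by move=> d dD; have [_ _ ->] := XP 0%N.
Qed.

(* [F] separates the points of [W] and [D] contains [F] and its translates by
   the generators: agreement with a point of [W] then propagates from [F] to
   every translate of [F]. *)
Lemma finite_dimensional_finite_type (W : set (G -> A)) :
  finitely_generated G -> finite_dimensional W ->
  (forall c x y, W x -> W y -> W (c *: x + y)) ->
  (forall g x, W x -> W (shift g x)) ->
  exists D : seq G, forall y,
    (forall g, exists2 w, W w & {in D, shift g y =1 w}) -> W y.
Proof.
move=> [S genS] /finite_dimensional_window [F FP] Wlin Wsh.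
have inj w w' : W w -> W w' -> {in F, w =1 w'} -> w = w'.
  move=> Ww Ww' ww'; have : -1 *: w' + w = 0.
    apply: FP; first exact: Wlin.
    by move=> g gF; rewrite !fctE ww' // scaleN1r addNr.
  by rewrite scaleN1r addrC => /subr0_eq.
(* The entry [1%g] reads off [y g] as the value at [1%g] of a translate of [y]. *)
pose D := 1%g :: F ++ [seq (s * f)%g | s <- enum_fset S, f <- F].
exists D.
pose Y : set (G -> A) := [set y | forall g, exists2 w, W w & {in D, shift g y =1 w}].
have Ysh g y : Y y -> Y (shift g y) by move=> Yy h; rewrite shiftM.
have YF y : Y y -> exists2 w, W w & {in D, y =1 w}.
  by move=> /(_ 1%g); rewrite shift1.
have FD : {subset F <= D} by move=> f fF; rewrite inE mem_cat fF orbT.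
(* These are the [g] for which agreement on [F] forces agreement on [g F]. They form a subgroup
   containing [S], hence all of [G]. *)
pose H : set G := [set g | forall y w, Y y -> W w -> {in F, y =1 w} ->
  {in F, shift g^-1%g y =1 shift g^-1%g w}].
have HV g : H g -> H g^-1%g.
  move=> Hg y w Yy Ww yw; rewrite invgK.
  (* Match the translate of [y] by [g] with a point [w'] of [W]; pulling back by [Hg], the translate
     of [w'] by [g^-1] agrees with [w] on [F], so they coincide. *)
  have [w' Ww' yw'] := YF _ (Ysh g _ Yy).
  have gyw' : {in F, shift g y =1 w'} by move=> f /FD/yw'.
  have := Hg _ _ (Ysh g _ Yy) Ww' gyw'; rewrite shiftVK => yw''.
  suff -> : w = shift g^-1%g w'.
    by move=> f fF; rewrite shiftM mulgV shift1 gyw'.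
  by apply: inj => //; [exact: Wsh | move=> f fF; rewrite -yw // yw''].
have HT : H = [set: G].
  apply: genS.
    split; first by apply: mem_set => y w _ _ yw; rewrite invg1 !shift1.
    move=> g h /set_mem Hg /set_mem/HV Hh; apply: mem_set => y w Yy Ww yw.
    rewrite invgM -!shiftM.
    exact: Hh (Ysh _ _ Yy) (Wsh _ _ Ww) (Hg _ _ Yy Ww yw).
  move=> s /= sS y w Yy Ww yw f fF.
  have [w' Ww' yw'] := YF _ Yy.
  have -> : w = w' by apply: inj => // k kF; rewrite -yw // yw' // FD.
  rewrite /shift invgK; apply: yw'; rewrite inE mem_cat; apply/orP; right.
  by apply/orP; right; apply/allpairsP; exists (s, f).
move=> y Yy; have [w Ww yw] := YF _ Yy.
suff -> : y = w by [].
apply/funext => g.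
have ywF : {in F, y =1 w} by move=> f /FD/yw.
have Hall h : H h by rewrite HT.
have [w' Ww' yw'] := YF _ (Ysh g^-1%g _ Yy).
have w'E : w' = shift g^-1%g w.
  apply: inj => //; first exact: Wsh.
  move=> f fF; rewrite -(Hall g y w Yy Ww ywF) // yw' //; exact: FD.
have := yw' 1%g (mem_head _ _).
by rewrite w'E /shift invgK mulg1.
Qed.

(** On the defining window [D] of [O], each translate of a point of a late image agrees with a point
    of [O], so the point itself lies in [O]. *)
Lemma finite_dimensional_limit (O : set (G -> A)) : finitely_generated G ->
  O = \bigcap_(n in [set n | (1 <= n)%N]) (iter n T @` Sigma) ->
  finite_dimensional O -> exists n, O = iter n T @` Sigma.
Proof.
move=> Gfg OE Ofd.
have [S0 SS] := linear_subshift_subspace.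
have Osh g x : O x -> O (shift g x).
  rewrite OE => Ox n n1; have [z Sz <-] := Ox n n1.
  exists (shift g z); first exact: linear_subshift_shift.
  by rewrite (local_linear_shift _ (local_linear_iter _ n TL)).
have Olin c x y : O x -> O y -> O (c *: x + y).
  rewrite OE => Ox Oy n n1; have [z Sz <-] := Ox n n1.
  have [z' Sz' <-] := Oy n n1; exists (c *: z + z'); first exact: SS.
  by rewrite (local_linear_comb _ (local_linear_iter _ n TL)).
have [D DP] := finite_dimensional_finite_type _ Gfg Ofd Olin Osh.
have [n nP] := iter_image_window_stable D.
(* The intersection runs over positive exponents, and [n] may be zero. *)
exists n.+1; apply/seteqP; split; first by rewrite OE => x; apply.
move=> _ [x Sx <-]; apply: DP => g.
have [m|w wP Dw] := limit_set_window D (shift g (iter n.+1 T x)).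
  rewrite -(local_linear_shift _ (local_linear_iter _ n.+1 TL)) iterSr.
  by apply: nP; apply/TS/linear_subshift_shift.
by exists w => //; rewrite OE => m _; exact: wP.
Qed.

End LinearSubshifts.

(** * Closing the cycle of implications *)

Theorem theorem1p9 (G : groupType) (K : fieldType) (A : vectType K)
    (Gfg : finitely_generated G) (Ginf : infinite_set [set: G])
    (Sigma : set (G -> A)) (Sigma_subshift : linear_subshift Sigma)
    (Sigma_mixing : topologically_mixing Sigma)
    (tau : Sigma -> Sigma) (tau_CA : linear_CA_on tau) :
  [<-> nilpotent_map tau;
       pointwise_nilpotent_map tau;
       exists n0 : nat, finite_dimensional (iter_image tau n0);
       finite_dimensional (limit_set tau);
       limit_set tau = [set 0]].
Proof.
have [T /linear_CA_local_linear TL tauE] := tau_CA.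
have [S0 _] := linear_subshift_subspace Sigma_subshift.
have toS x (Sx : Sigma x) : exists s : Sigma, val s = x.
  by exists (exist _ x (mem_set Sx)).
have TS x : Sigma x -> Sigma (T x).
  by move=> /toS [s <-]; rewrite -tauE; exact: set_valP.
have iterE n (s : Sigma) : val (iter n tau s) = iter n T (val s).
  by elim: n => // n IH; rewrite !iterS tauE IH.
have imE n : iter_image tau n = iter n T @` Sigma.
  apply/seteqP; split=> [_ [s _ <-]|_ [x /toS [s <-] <-]].
    by rewrite iterE; exists (val s) => //; exact: set_valP.
  by rewrite -iterE; exists s.
have limE : limit_set tau =
    \bigcap_(n in [set n | (1 <= n)%N]) (iter n T @` Sigma).
  by apply: eq_bigcapr => n _; rewrite imE.
have [s0 s0E] := toS 0 S0.
have T0 n : iter n T 0 = 0 := local_linear0 _ (local_linear_iter _ n TL).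
(* Nilpotency expressed on [A^G] is the hub: finite dimension of an image or of the limit set leads
   to it. *)
pose nilT := exists n, forall u, Sigma u -> iter n T u = 0.
have nil_a : nilT -> nilpotent_map tau.
  (* The successor ensures a positive exponent. *)
  move=> [n nP]; exists s0, n.+1; split=> //; apply/funext => s.
  apply: val_inj; rewrite iterE s0E /= nP //; last exact: set_valP.
  exact: (T0 1%N).
have fd0 : finite_dimensional [set (0 : G -> A)].
  exists 0%N, (fun=> 0); apply/seteqP; split=> [_ ->|_ [c ->]].
    by exists (fun=> 0); rewrite big_ord0.
  by rewrite big_ord0.
have nil_im n : (forall u, Sigma u -> iter n T u = 0) ->
    iter n T @` Sigma = [set 0].
  move=> nP; apply/seteqP; split=> [_ [u Su <-]|_ ->]; first exact: nP.
  by exists 0.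
have nil_e : nilT -> limit_set tau = [set 0].
  move=> [n nP]; rewrite limE; apply/seteqP; split=> [x xP|_ -> m _].
    have [u Su <-] := xP n.+1 isT.
    by rewrite /= nP //; exact: (T0 1%N).
  by exists 0.
have c_nil n : finite_dimensional (iter_image tau n) -> nilT.
  rewrite imE => fd; exists n.
  exact: (finite_dimensional_image_zero Sigma_subshift TL Ginf).
have d_nil : finite_dimensional (limit_set tau) -> nilT.
  move=> fd; have [n nE] :=
    finite_dimensional_limit Sigma_subshift TL TS _ Gfg limE fd.
  by apply: (c_nil n); rewrite imE -nE.
tfae.
- move=> [c [n0 [n0_gt0 nE]]]; exists c => x; exists n0; split=> // n le.
  by rewrite -(subnKC le) iterD nE.
- move=> [x0 x0P].
  have x00 : val x0 = 0.
    (* The orbit of zero is constant, so the common limit point must be zero. *)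
    have [n [_ /(_ n (leqnn n)) <-]] := x0P s0.
    by rewrite iterE s0E.
  have [|n nP] := pointwise_nilpotent_nilpotent Sigma_subshift TL Ginf Sigma_mixing.
    move=> x /toS [s <-]; have [n [_ /(_ n (leqnn n)) nE]] := x0P s.
    by exists n; rewrite -iterE nE.
  by exists n; rewrite imE nil_im.
- by move=> [n /c_nil /nil_e ->].
- by move=> /d_nil/nil_e.
- by move=> E; apply/nil_a/d_nil; rewrite E.
Qed.
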